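(* Let $(d_n)_{n\ge1}$ be a fixed sequence of integers $d_n\ge2$. Let $m\ge1$, let $0<k_1<k_2<\dots<k_m$ be integers and let $c_i\in\{0,1,\dots,d_{k_i}-1\}$ for $i=1,\dots,m$. The diameter of the set $\Delta^{k_1k_2\ldots k_m}_{c_1c_2\ldots c_m}$ is $$d\left(\Delta^{k_1k_2\ldots k_m}_{c_1c_2\ldots c_m}\right)=1-\sum_{i=1}^{m}\frac{d_{k_i}-1}{d_1d_2\cdots d_{k_i}},$$ where $d_1d_2\cdots d_{k_i}$ is the product of all $d_j$ with $1\le j\le k_i$.
   Context: Put $a_0=\sum_{n=1}^{\infty}\frac{(-1)^{n+1}}{d_1d_2\cdots d_n}$. For digits $\varepsilon_n\in\{0,\dots,d_n-1\}$ put $\Delta^{-D}_{\varepsilon_1\varepsilon_2\ldots}=\sum_{n=1}^{\infty}\frac{(-1)^n\varepsilon_n}{d_1d_2\cdots d_n}$; every number of $[a_0-1;a_0]$ has such a representation. The set $\Delta^{k_1k_2\ldots k_m}_{c_1c_2\ldots c_m}$ is the set of all numbers of $[a_0-1;a_0]$ having a representation $\Delta^{-D}_{\varepsilon_1\varepsilon_2\ldots}$ with $\varepsilon_{k_i}=c_i$ for all $i=1,\dots,m$. *)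

(* Defs.v *)
From HB Require Import structures.
From mathcomp Require Import all_boot all_order all_algebra.
From mathcomp Require Import all_classical all_reals all_analysis.

Set Implicit Arguments.
Unset Strict Implicit.
Unset Printing Implicit Defensive.

Import Order.TTheory GRing.Theory Num.Theory.
Import numFieldNormedType.Exports.

Local Open Scope classical_set_scope.
Local Open Scope ring_scope.

(* Sequences (d_n) and (eps_n) are indexed from 1; their values at 0 are never
   used. *)

Definition dprod (d : nat -> nat) (n : nat) : nat :=
  (\prod_(1 <= j < n.+1) d j)%N.

Definition digits (d eps : nat -> nat) : Prop :=
  forall n : nat, (1 <= n)%N -> (eps n < d n)%N.

Definition a0 (R : realType) (d : nat -> nat) : R :=
  limn (fun N => \sum_(1 <= n < N) (-1) ^+ n.+1 / (dprod d n)%:R : R).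

(* The number Delta^{-D}_{eps_1 eps_2 ...}. If d_n >= 2 for all n >= 1 and eps
   satisfies [digits d eps], the series converges absolutely, being dominated by
   the telescoping series of (d_n - 1) / (d_1 ... d_n). *)
Definition negD (R : realType) (d eps : nat -> nat) : R :=
  limn (fun N => \sum_(1 <= n < N) (-1) ^+ n * (eps n)%:R / (dprod d n)%:R : R).

(* The indices i = 1, ..., m are represented by the elements of 'I_m. *)
Definition DeltaSet (R : realType) (d : nat -> nat) (m : nat)
    (k c : 'I_m -> nat) : set R :=
  [set x | a0 R d - 1 <= x <= a0 R d /\
     exists eps : nat -> nat,
       [/\ digits d eps, x = negD R d eps & forall i : 'I_m, eps (k i) = c i]].

(* Taken in the extended reals, so that a finite value of the diameter includes
   that A is nonempty and bounded. *)
Definition diameter (R : realType) (A : set R) : \bar R :=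
  ereal_sup [set (`|x - y|)%:E | x in A & y in A].

(* Main.v *)
Require Import Defs.
From mathcomp Require Import all_boot all_order all_algebra.
From mathcomp Require Import all_classical all_reals all_analysis.
From mathcomp Require Import ring lra.
Import Order.TTheory GRing.Theory Num.Theory.
Local Open Scope ring_scope.

Set Implicit Arguments.
Unset Strict Implicit.
Unset Printing Implicit Defensive.
Import numFieldNormedType.Exports.
Local Open Scope classical_set_scope.

(** Write [D_n = d_1 ... d_n] and call [w_n = (d_n - 1) / D_n] the weight of
    the index [n]; it is the largest value of [|eps_n - eps'_n| / D_n] for two
    digits [eps_n], [eps'_n].  Since [w_n = 1 / D_(n-1) - 1 / D_n], the weights
    telescope and their sum is 1; this gives the absolute convergence of every
    series involved.

    Two points of the cylinder have the same digits at the prescribed positions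
    [k_i], so their distance is at most the sum of the weights of all the other
    (free) indices, which is [1 - \sum_i w_(k_i)].  The bound is attained: put
    [d_n - 1] at the free even indices and 0 at the free odd ones for one point,
    and exchange the two parities for the other; every free index [n] then
    contributes exactly [w_n] to the difference.

    Finally, any expansion lies between the one with digits [d_n - 1] at the odd
    indices and 0 at the even ones, and the one with the parities exchanged.  By
    telescoping, these have the sums [a_0 - 1] and [a_0], so that the interval
    condition in the definition of the cylinder holds automatically. *)

(** * Telescoping weights *)

Section Weights.
Variables (R : realType) (d : nat -> nat).
Hypothesis hd : forall n : nat, (1 <= n)%N -> (2 <= d n)%N.

(** The weight [(d_n - 1) / (d_1 ... d_n)] of the index [n]. *)
Definition weight (n : nat) : R := ((d n)%:R - 1) / (dprod d n)%:R.

Lemma dprod0 : dprod d 0 = 1%N.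
Proof. by rewrite /dprod big_geq. Qed.

Lemma dprodS n : dprod d n.+1 = (dprod d n * d n.+1)%N.
Proof. by rewrite /dprod big_nat_recr. Qed.

Lemma ltn_dprod n : (n < dprod d n)%N.
Proof.
elim: n => [|n IH]; first by rewrite dprod0.
rewrite dprodS; apply: (@leq_trans (dprod d n * 2)).
  by rewrite muln2 -addnn -addn1 leq_add // (leq_trans _ IH).
by rewrite leq_mul2l hd // orbT.
Qed.

Lemma dprod_gt0 n : 0 < (dprod d n)%:R :> R.
Proof. by rewrite ltr0n (leq_trans _ (ltn_dprod n)). Qed.

Lemma weightS n :
  weight n.+1 = (dprod d n)%:R^-1 - (dprod d n.+1)%:R^-1.
Proof.
rewrite /weight dprodS natrM.
have h1 : (dprod d n)%:R != 0 :> R by rewrite gt_eqF // dprod_gt0.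
have h2 : (d n.+1)%:R != 0 :> R.
  by rewrite pnatr_eq0 -lt0n (leq_trans _ (hd (isT : 1 <= n.+1)%N)).
by field; rewrite h1 h2.
Qed.

Lemma weight_ge0 n : (1 <= n)%N -> 0 <= weight n.
Proof.
move=> n1; rewrite divr_ge0 ?ler0n // subr_ge0 ler1n.
exact: leq_trans (hd n1).
Qed.

Lemma sum_weight N :
  \sum_(1 <= n < N.+1) weight n = 1 - (dprod d N)%:R^-1.
Proof.
elim: N => [|N IH]; first by rewrite big_geq // dprod0 invr1 subrr.
by rewrite big_nat_recr //= IH weightS; ring.
Qed.

Lemma sum_weight_le1 N : \sum_(1 <= n < N) weight n <= 1.
Proof.
case: N => [|N]; first by rewrite big_geq // ler01.
by rewrite sum_weight gerBl invr_ge0 ler0n.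
Qed.

Lemma inv_dprod_cvg0 : (fun n => (dprod d n)%:R^-1 : R) @ \oo --> (0 : R).
Proof.
apply: (@squeeze_cvgr _ _ _ _ (fun=> 0) harmonic); last 2 first.
- exact: cvg_cst.
- exact: cvg_harmonic.
apply: nearW => n; rewrite invr_ge0 ler0n /=.
by rewrite lef_pV2 ?posrE ?dprod_gt0 ?ltr0n // ler_nat ltn_dprod.
Qed.

Lemma sum_weight_cvg : (fun N => \sum_(1 <= n < N) weight n) @ \oo --> (1 : R).
Proof.
rewrite -cvg_shiftS /=.
under eq_fun do rewrite sum_weight.
by have := cvgB (cvg_cst (1 : R)) inv_dprod_cvg0; rewrite subr0; exact.
Qed.

(** * Expansions and the interval that contains them *)

Lemma dominated_sum_is_cvg (t : nat -> R) :
  (forall n, (1 <= n)%N -> `|t n| <= weight n) ->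
  cvgn (fun N => \sum_(1 <= n < N) t n).
Proof.
move=> tw.
(* The term of index 0 is replaced by 0, to start the summation at 0. *)
pose t' n := if n is 0%N then 0 else t n.
have t'E (f : R -> R) N : f 0 = 0 ->
    \sum_(0 <= n < N) f (t' n) = \sum_(1 <= n < N) f (t n).
  move=> f0; case: N => [|N]; first by rewrite !big_geq.
  rewrite big_ltn //= f0 add0r; apply: eq_big_nat => -[|n] //.
have -> : (fun N => \sum_(1 <= n < N) t n) = series t'.
  by apply/funext => N; rewrite seriesEnat /= (t'E id).
apply: normed_cvg; apply: nondecreasing_is_cvgn.
  by apply: nondecreasing_series => n _ _; exact: normr_ge0.
exists 1 => _ [N _ <-].
suff: \sum_(0 <= n < N) `|t' n| <= 1 by [].
rewrite (t'E Num.norm) ?normr0 //.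
apply: le_trans (sum_weight_le1 N).
by apply: ler_sum_nat => n /andP[n1 _]; exact: tw.
Qed.

(** The partial sums in the definitions of [negD] and [a0]. *)
Definition negD_sum (e : nat -> nat) (N : nat) : R :=
  \sum_(1 <= n < N) (-1) ^+ n * (e n)%:R / (dprod d n)%:R.

Definition a0_sum (N : nat) : R :=
  \sum_(1 <= n < N) (-1) ^+ n.+1 / (dprod d n)%:R.

Lemma digit_le (e : nat -> nat) n : digits d e -> (1 <= n)%N ->
  (e n)%:R <= (d n)%:R - 1 :> R.
Proof. by move=> de n1; rewrite lerBrDr natr1 ler_nat; exact: de. Qed.

Lemma negD_cvg e : digits d e -> negD_sum e @ \oo --> negD R d e.
Proof.
move=> de; apply: dominated_sum_is_cvg => n n1.
rewrite -mulrA normrMsign ger0_norm ?divr_ge0 ?ler0n //.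
by rewrite ler_pM2r ?invr_gt0 ?dprod_gt0 // digit_le.
Qed.

Lemma a0_cvg : a0_sum @ \oo --> a0 R d.
Proof.
apply: dominated_sum_is_cvg => n n1.
rewrite normrMsign ger0_norm ?invr_ge0 ?ler0n // -[leLHS]mul1r.
rewrite ler_pM2r ?invr_gt0 ?dprod_gt0 // lerBrDr.
by rewrite (ler_nat _ 2); exact: hd.
Qed.

(** By telescoping, the upper bound is the sum of the weights of the even
    indices [n <= N], and the lower bound is the opposite of the sum of the
    weights of the odd ones. *)
Lemma negD_sum_bounds e N : digits d e ->
  a0_sum N.+1 - 1 + (~~ odd N)%:R / (dprod d N)%:R <= negD_sum e N.+1
    <= a0_sum N.+1 - (odd N)%:R / (dprod d N)%:R.
Proof.
move=> de; elim: N => [|N /andP[IHl IHr]].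
  by rewrite /a0_sum /negD_sum !big_geq // dprod0 invr1 /= mulr1n mulr0n; lra.
have p0 := dprod_gt0 N.+1; have n1 : (1 <= N.+1)%N by [].
have w0 : 0 <= (e N.+1)%:R / (dprod d N.+1)%:R :> R by rewrite divr_ge0 ?ler0n.
have w1 : (e N.+1)%:R / (dprod d N.+1)%:R <= weight N.+1.
  by rewrite ler_pM2r ?invr_gt0 // digit_le.
rewrite weightS in w1.
have -> : a0_sum N.+2 = a0_sum N.+1 + (-1) ^+ N.+2 / (dprod d N.+1)%:R.
  by rewrite /a0_sum big_nat_recr.
have -> : negD_sum e N.+2 =
    negD_sum e N.+1 + (-1) ^+ N.+1 * ((e N.+1)%:R / (dprod d N.+1)%:R).
  by rewrite /negD_sum big_nat_recr //= mulrA.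
move: IHl IHr w0 w1; rewrite -(signr_odd _ N.+1) -(signr_odd _ N.+2) /=.
set x := (e N.+1)%:R / _; set y := (dprod d N)%:R^-1.
set z := (dprod d N.+1)%:R^-1.
case: (odd N) => /=; rewrite ?expr0 ?expr1 ?mulr1n ?mulr0n; lra.
Qed.

Lemma negD_itv e : digits d e -> a0 R d - 1 <= negD R d e <= a0 R d.
Proof.
move=> de; have cA := a0_cvg; have cD := negD_cvg de.
have q N : 0 <= (dprod d N)%:R^-1 :> R by rewrite invr_ge0 ler0n.
have bnd N : a0_sum N - 1 <= negD_sum e N <= a0_sum N.
  case: N => [|N]; first by rewrite /a0_sum /negD_sum !big_geq //; lra.
  have /andP[] := negD_sum_bounds N de; have := q N.
  by case: (odd N) => /=; rewrite ?mulr1n ?mulr0n; lra.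
apply/andP; split.
  have cA1 : (fun N => a0_sum N - 1) @ \oo --> a0 R d - 1.
    by apply: cvgB; [exact: cA|exact: cvg_cst].
  apply: (ler_cvg_to cA1 cD).
  by apply: nearW => N; case/andP: (bnd N).
by apply: (ler_cvg_to cD cA); apply: nearW => N; case/andP: (bnd N).
Qed.

(** * Distances between the points of a cylinder *)

Section Cylinder.
Variables (m : nat) (k c : 'I_m -> nat).
Hypothesis hk0 : forall i : 'I_m, (0 < k i)%N.
Hypothesis injk : injective k.
Hypothesis hc : forall i : 'I_m, (c i < d (k i))%N.

(** The sum of the weights of the free indices [n] with [1 <= n < N], an index
    being free if it is none of the [k_i]. *)
Definition free_weight_sum (N : nat) : R :=
  \sum_(1 <= n < N) (if n \in codom k then 0 else weight n).

Lemma free_weight_sumE N : (forall i, k i < N)%N ->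
  free_weight_sum N = \sum_(1 <= n < N) weight n - \sum_(i < m) weight (k i).
Proof.
move=> kN; apply/eqP; rewrite eq_sym subr_eq addrC -subr_eq -sumrB; apply/eqP.
transitivity (\sum_(1 <= n < N) \sum_(i < m)
    (if n == k i then weight n else 0)).
  apply: eq_bigr => n _; case: ifPn => [/codomP[i ->]|nk].
    rewrite subr0 (bigD1 i) //= eqxx big1 ?addr0 // => j ji.
    by rewrite (inj_eq injk) eq_sym (negbTE ji).
  rewrite subrr big1 // => i _; case: eqP => // nki.
  by case/negP: nk; rewrite nki codom_f.
rewrite exchange_big /=; apply: eq_bigr => i _.
by rewrite -big_mkcond /= big_nat1_eq hk0 kN.
Qed.

Lemma free_weight_sum_cvg :
  free_weight_sum @ \oo --> 1 - \sum_(i < m) weight (k i).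
Proof.
apply: (@cvg_trans _
  ((fun N => \sum_(1 <= n < N) weight n - \sum_(i < m) weight (k i)) @ \oo)).
  apply: near_eq_cvg; near=> N; rewrite free_weight_sumE // => i.
  apply: (@leq_ltn_trans (\max_(i < m) k i)); first exact: leq_bigmax.
  by near: N; exact: nbhs_infty_gt.
by apply: cvgB; [exact: sum_weight_cvg|exact: cvg_cst].
Unshelve. all: by end_near. Qed.

Lemma dist_negD_le e e' : digits d e -> digits d e' ->
  (forall i, e (k i) = c i) -> (forall i, e' (k i) = c i) ->
  `|negD R d e - negD R d e'| <= 1 - \sum_(i < m) weight (k i).
Proof.
move=> de de' ec ec'.
have cdiff : (fun N => `|negD_sum e N - negD_sum e' N|) @ \oo -->
    `|negD R d e - negD R d e'|.
  by apply: cvg_norm; apply: cvgB; exact: negD_cvg.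
apply: (ler_cvg_to cdiff free_weight_sum_cvg).
apply: nearW => N; rewrite -sumrB; apply: le_trans (ler_norm_sum _ _ _) _.
apply: ler_sum_nat => n /andP[n1 _].
rewrite -!mulrA -mulrBr -mulrBl normrMsign.
case: ifPn => [/codomP[i ->]|_]; first by rewrite ec ec' subrr mul0r normr0.
rewrite normrM [X in _ * X]ger0_norm ?invr_ge0 ?ler0n //.
rewrite ler_pM2r ?invr_gt0 ?dprod_gt0 //.
have := digit_le de n1; have := digit_le de' n1.
have := ler0n R (e n); have := ler0n R (e' n).
by rewrite ler_norml; lra.
Qed.

(** The digits [c_i] at the prescribed positions [k_i]; elsewhere [d_n - 1] at
    the odd (if [b] is true) or even (if [b] is false) indices, and 0 at the
    others. *)
Definition extremal_digits (b : bool) (n : nat) : nat :=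
  if [pick i | k i == n] is Some i then c i
  else if odd n == b then (d n).-1 else 0%N.

Lemma extremal_digits_fixed b i : extremal_digits b (k i) = c i.
Proof.
rewrite /extremal_digits; case: pickP => [j /eqP/injk ->//|/(_ i)].
by rewrite eqxx.
Qed.

Lemma extremal_digits_free b n : n \notin codom k ->
  extremal_digits b n = if odd n == b then (d n).-1 else 0%N.
Proof.
move=> nk; rewrite /extremal_digits; case: pickP => // i /eqP ki.
by case/negP: nk; rewrite -ki codom_f.
Qed.

Lemma digits_extremal b : digits d (extremal_digits b).
Proof.
move=> n n1; have d2 := hd n1.
have [/codomP[i ->]|nk] := boolP (n \in codom k).
  by rewrite extremal_digits_fixed.
rewrite extremal_digits_free //.
by case: ifP => _; [rewrite prednK|]; rewrite // (leq_trans _ d2).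
Qed.

Lemma extremal_digits_DeltaSet b :
  @DeltaSet R d m k c (negD R d (extremal_digits b)).
Proof.
split; first exact: negD_itv (digits_extremal b).
exists (extremal_digits b); split => //; first exact: digits_extremal.
exact: extremal_digits_fixed.
Qed.

Lemma negD_extremalB :
  negD R d (extremal_digits false) - negD R d (extremal_digits true) =
  1 - \sum_(i < m) weight (k i).
Proof.
apply: (cvg_unique _ _ free_weight_sum_cvg); first exact: norm_hausdorff.
have -> : free_weight_sum =
    (fun N => negD_sum (extremal_digits false) N
              - negD_sum (extremal_digits true) N).
  apply/funext => N; rewrite /= -sumrB; symmetry.
  apply: eq_big_nat => n /andP[n1 _].
  rewrite -!mulrA -mulrBr -mulrBl.
  have [/codomP[i ->]|nk] := boolP (n \in codom k).
    by rewrite !extremal_digits_fixed subrr mul0r mulr0.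
  have dE : (d n).-1%:R = (d n)%:R - 1 :> R.
    by rewrite -subn1 natrB // (leq_trans _ (hd n1)).
  rewrite !extremal_digits_free // /weight -signr_odd.
  by case: (odd n) => /=; rewrite dE ?expr1 ?expr0; ring.
by apply: cvgB; apply: negD_cvg; exact: digits_extremal.
Qed.

(** The diameter for prescribed positions that are pairwise distinct, in any
    order. *)
Lemma diameter_DeltaSet :
  diameter (@DeltaSet R d m k c) = (1 - \sum_(i < m) weight (k i))%:E.
Proof.
apply/eqP; rewrite eq_le; apply/andP; split.
  apply: ge_ereal_sup => _ [x [_ [e [de -> ec]]] [y [_ [e' [de' -> ec']]] <-]].
  by rewrite lee_fin; exact: dist_negD_le.
apply: ereal_sup_ubound.
exists (negD R d (extremal_digits false)).
  exact: extremal_digits_DeltaSet.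
exists (negD R d (extremal_digits true)).
  exact: extremal_digits_DeltaSet.
rewrite negD_extremalB ger0_norm //.
have e_fixed := extremal_digits_fixed true; have de := digits_extremal true.
exact: le_trans (normr_ge0 _) (dist_negD_le de de e_fixed e_fixed).
Qed.

End Cylinder.
End Weights.

Theorem lemma20 (R : realType) (d : nat -> nat)
    (hd : forall n : nat, (1 <= n)%N -> (2 <= d n)%N)
    (m : nat) (hm : (1 <= m)%N) (k c : 'I_m -> nat)
    (hk0 : forall i : 'I_m, (0 < k i)%N)
    (hk : forall i j : 'I_m, (i < j)%N -> (k i < k j)%N)
    (hc : forall i : 'I_m, (c i < d (k i))%N) :
  diameter (@DeltaSet R d m k c) =
  (1 - \sum_(i < m) ((d (k i))%:R - 1) / (dprod d (k i))%:R)%:E.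
Proof.
apply: diameter_DeltaSet => // i j kij; apply/ord_inj.
by case: (ltngtP i j) => // /hk; rewrite kij ltnn.
Qed.
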